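(* Let $\mathbf{T}=(T_1,\dots,T_d)\in\mathcal{B}(\mathcal{H})^d$. Then: (i) If $T_1,\dots,T_d$ are bounded linear operators on a two-dimensional Hilbert space $\mathcal{H}$ and $|q|\le 1$, then $JtW_q(\mathbf{T})=JtW_C(\mathbf{T})$ for $C=\begin{pmatrix} q & \sqrt{1-|q|^2}\\ 0&0\end{pmatrix}$. (ii) If $T_1,\dots,T_d$ and $C$ are $n\times n$ matrices ($n\ge 2$) and $|q|\le 1$, then $JtW_q(\mathbf{T})=JtW_C(\mathbf{T})$, where $C=\begin{pmatrix} q & \sqrt{1-|q|^2}\\ 0&0\end{pmatrix}\oplus 0_{n-2}$. (iii) If $C$ is an $n\times n$ rank one matrix and $q\in[0,1]$, then $JtW_C(\mathbf{T})=\mu\, JtW_q(\mathbf{T})$, where $\mu$ is a non-zero scalar.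
   Context: $d$ is a positive integer and $q$ is a complex number with $|q|\le 1$. $\mathcal{H}$ is a complex Hilbert space with $\dim\mathcal{H}\ge2$ and $\mathcal{B}(\mathcal{H})$ is the algebra of bounded linear operators on $\mathcal{H}$; when the operators are $n\times n$ complex matrices, as in (ii) and (iii), $\mathcal{H}=\mathbb{C}^n$ with the standard inner product and $n\ge 2$. Put $\mathbb{S}_q(\mathcal{H})=\{(x,y)\in\mathcal{H}\times\mathcal{H}: \|x\|=\|y\|=1,\ \langle x,y\rangle=q\}$, where $\langle\cdot,\cdot\rangle$ is linear in the first variable. The joint $q$-numerical range is $JtW_q(\mathbf{T})=\{(\langle T_1x,y\rangle,\dots,\langle T_dx,y\rangle)\in\mathbb{C}^d : (x,y)\in\mathbb{S}_q(\mathcal{H})\}$. For $n\times n$ complex matrices $T_1,\dots,T_d$ and a fixed $n\times n$ complex matrix $C$, the joint $C$-numerical range is $JtW_C(\mathbf{T})=\{(\operatorname{tr}(CU^*T_1U),\dots,\operatorname{tr}(CU^*T_dU)) : U \text{ an } n\times n\text{ unitary matrix}\}$, where $\operatorname{tr}$ is the trace. Operators on a two-dimensional Hilbert space are identified with their $2\times 2$ matrices in an orthonormal basis (the set $JtW_C(\mathbf{T})$ does not depend on the choice). $0_{n-2}$ is the $(n-2)\times(n-2)$ zero matrix (absent if $n=2$). For $\mu\in\mathbb{C}$ and $E\subseteq\mathbb{C}^d$, $\mu E=\{\mu\xi:\xi\in E\}$.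
   Formalization: In (iii), q is not arbitrary in [0,1]: for each rank one C there exist some q in [0,1] and non-zero μ, depending only on C, with JtW_C(T) = μ JtW_q(T) for all T. For arbitrary q it fails (n=2, d=1, C=E11, q=0, T=diag(1,0): a segment versus a disc). *)

(* Defs.v *)
From HB Require Import structures.
From mathcomp Require Import all_boot all_order all_algebra sesquilinear spectral.
From mathcomp Require Import boolp classical_sets reals complex.

Set Implicit Arguments.
Unset Strict Implicit.
Unset Printing Implicit Defensive.

Import Order.TTheory GRing.Theory Num.Theory Num.Def.
Local Open Scope ring_scope.
Local Open Scope classical_set_scope.
Local Open Scope sesquilinear_scope.

(* The standard inner product of C^n, on column vectors so that a matrix A acts
   by x |-> A *m x (the library's [dotmx] lives on row vectors). *)
Section StandardInnerProduct.
Context {C : numClosedFieldType} {n : nat}.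

Definition dotcv (x y : 'cV[C]_n) : C := \sum_i x i 0 * conjC (y i 0).

Lemma dotcvE x y : dotcv x y = dotmx x^T y^T.
Proof. by rewrite dotmxE mxE; apply: eq_bigr => i _; rewrite !mxE. Qed.

Fact dotcv_bilinear : bilinear_for
  (GRing.Scale.Law.clone _ _ *%R _) (GRing.Scale.Law.clone _ _ (conjC \; *%R) _)
  dotcv.
Proof.
split=> [y a x1 x2|x a y1 y2] /=; rewrite /dotcv mulr_sumr -big_split /=;
  apply: eq_bigr => i _; rewrite !mxE.
  by rewrite mulrDl mulrA.
by rewrite rmorphD rmorphM mulrDr mulrCA.
Qed.
HB.instance Definition _ :=
  bilinear_isBilinear.Build C _ _ _ _ _ dotcv dotcv_bilinear.

Fact dotcv_hermitian x y : dotcv x y = (-1) ^+ false * conjC (dotcv y x).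
Proof.
rewrite expr0 mul1r /dotcv rmorph_sum; apply: eq_bigr => i _.
by rewrite rmorphM /= conjCK mulrC.
Qed.
HB.instance Definition _ :=
  isHermitianSesquilinear.Build C _ _ _ dotcv dotcv_hermitian.

Fact dotcv_gt0 x : x != 0 -> 0 < dotcv x x.
Proof. by move=> x0; rewrite dotcvE (dnorm_gt0 (@dotmx C n)) trmx_eq0. Qed.
HB.instance Definition _ := isDotProduct.Build C _ dotcv dotcv_gt0.

End StandardInnerProduct.

Section JointNumericalRanges.
Variables (C : numClosedFieldType) (d : nat).

(* [{dot H for conjC}] is linear in its first argument. Completeness of H and
   boundedness of the operators play no role in these definitions, and are
   automatic in finite dimension. *)
Section OnInnerProductSpaces.
Variables (H : lmodType C) (dot : {dot H for conjC}).

Definition hnorm (x : H) : C := sqrtC (dot x x).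

Definition Sq (q : C) : set (H * H) :=
  [set xy | [/\ hnorm xy.1 = 1, hnorm xy.2 = 1 & dot xy.1 xy.2 = q]].

Definition JtWq (q : C) (T : 'I_d -> H -> H) : set 'rV[C]_d :=
  [set \row_(k < d) dot (T k xy.1) xy.2 | xy in Sq q].

End OnInnerProductSpaces.

Definition JtWC (n : nat) (A : 'M[C]_n) (T : 'I_d -> 'M[C]_n) : set 'rV[C]_d :=
  [set \row_(k < d) \tr (A *m U^t* *m T k *m U) | U in [set U | U \is unitarymx]].

Definition JtWqmx (n : nat) (q : C) (T : 'I_d -> 'M[C]_n) : set 'rV[C]_d :=
  JtWq (@dotcv C n) q (fun k x => T k *m x).

End JointNumericalRanges.

Definition Cq (C : numClosedFieldType) (q : C) : 'M[C]_2 :=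
  \matrix_(i < 2, j < 2)
    if i == 0 then (if j == 0 then q else sqrtC (1 - `|q| ^+ 2)) else 0.

Definition opmx (C : numClosedFieldType) (H : vectType C)
    (dot : {dot H for conjC}) (n : nat) (e : n.-tuple H) (f : H -> H) : 'M[C]_n :=
  \matrix_(i < n, j < n) dot (f (tnth e j)) (tnth e i).

(* Main.v *)
Require Import Defs.
From mathcomp Require Import all_boot all_order all_algebra sesquilinear spectral.
From mathcomp Require Import boolp classical_sets reals complex.

Import Order.TTheory GRing.Theory Num.Theory Num.Def.
Local Open Scope ring_scope.
Local Open Scope classical_set_scope.

(** All three parts come down to one fact: if [a] and [b] are unit vectors of
    C^n with [<a, b> = q], then the joint C-numerical range of the rank one
    matrix [a b^*] is the joint q-numerical range ([JtWC_rank1]).  Cyclicity of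
    the trace gives [tr (a b^* U^* T U) = <T (U a), U b>], and as [U] runs
    through the unitary group the pair [(U a, U b)] runs through all the pairs
    with the same Gram matrix as [(a, b)], which are exactly the elements of
    [S_q].

    That last transitivity statement ([unitary_of_gram]) holds for families of
    any length: two families with the same Gram matrix satisfy the same linear
    relations, so the combinations that orthonormalize the first one also
    orthonormalize the second one, and reconstruct it; completing both
    orthonormal families to orthonormal bases produces the unitary matrix.

    For (i) and (ii) the matrix [C] is [e_1 b^*] where
    [b = conj q e_1 + sqrt (1 - |q|^2) e_2] is a unit vector; (i) is moved to
    C^2 by the coordinates in the orthonormal basis ([JtWq_opmx]).  For (iii), a
    rank one matrix is [m a b^*] with [a] and [b] unit vectors; multiplying [a]
    by a unit scalar, compensated in [m], makes [<a, b>] equal to its modulus,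
    which is at most 1 by the Cauchy-Schwarz inequality. *)

(** * Unitary equivalence of families with the same Gram matrix *)

Section JointRanges.
Context {C : numClosedFieldType}.
Local Open Scope sesquilinear_scope.

Lemma mxadjM m n p (A : 'M[C]_(m, n)) (B : 'M_(n, p)) :
  (A *m B)^t* = B^t* *m A^t*.
Proof. by rewrite trmx_mul map_mxM. Qed.

(** The missing rows form an orthonormal basis of the orthogonal complement. *)
Lemma unitarymx_completion r n (B : 'M[C]_(r, n)) : B \is unitarymx ->
  exists Z : 'M[C]_(n - r, n), col_mx B Z \is unitarymx.
Proof.
move=> Bu; set O := orthomx conjC (mx_of_hermitian (hermitian1mx _)) B.
have rO : \rank O = (n - r)%N by rewrite rank_ortho mxrank_unitary.
have Zu : schmidt (row_base O) \is unitarymx.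
  by rewrite schmidt_unitarymx // rank_leq_col.
have ZB : schmidt (row_base O) *m B^t* = 0.
  by apply/orthomx1P; rewrite eqmx_schmidt_free ?row_base_free // eq_row_base.
move: (schmidt _) Zu ZB; rewrite rO => Z Zu ZB; exists Z.
have BZ : B *m Z^t* = 0.
  by rewrite -[B]trmxCK -mxadjM ZB trmx0 map_mx0.
apply/unitarymxP; rewrite tr_col_mx map_row_mx mul_col_row ZB BZ.
by rewrite (unitarymxP Bu) (unitarymxP Zu) -scalar_mx_block.
Qed.

(** If [W] and [W'] complete [B] and [B'] to orthonormal bases, then [W^* W']
    maps the rows of [W] to those of [W']. *)
Lemma unitarymx_transitive r n (B B' : 'M[C]_(r, n)) :
  B \is unitarymx -> B' \is unitarymx ->
  exists2 U : 'M[C]_n, U \is unitarymx & B' = B *m U.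
Proof.
move=> Bu B'u.
have [Z Wu] := unitarymx_completion _ _ _ Bu.
have [Z' W'u] := unitarymx_completion _ _ _ B'u.
have rn : (r + (n - r))%N = n.
  by rewrite subnKC // -(mxrank_unitary Bu) rank_leq_col.
exists ((col_mx B Z)^t* *m col_mx B' Z').
  apply/unitarymxP; rewrite mxadjM trmxCK mulmxA mulmxtVK //.
  by rewrite -[_^t*]mul1mx mulmxKtV.
have BW : B = row_mx 1%:M 0 *m col_mx B Z.
  by rewrite mul_row_col mul1mx mul0mx addr0.
rewrite {1}BW mulmxA mulmxtVK //.
by rewrite mul_row_col mul1mx mul0mx addr0.
Qed.

(** Gram-Schmidt on the rows of [X], with the combinations [K] made explicit so
    that they can be applied to another family. *)
Lemma orthonormalizing_rows m n (X : 'M[C]_(m, n)) :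
  exists r (K : 'M[C]_(r, m)),
    K *m X \is unitarymx /\ X = X *m (K *m X)^t* *m (K *m X).
Proof.
pose B := schmidt (row_base X).
have Bu : B \is unitarymx by rewrite schmidt_unitarymx // rank_leq_col.
have eqB : (B :=: X)%MS.
  apply: eqmx_trans (eq_row_base X).
  by apply: eqmx_schmidt_free; exact: row_base_free.
have /submxP[K BE] : (B <= X)%MS by rewrite eqB.
have /submxP[L XE] : (X <= B)%MS by rewrite eqB.
exists (\rank X), K; rewrite -BE; split=> //.
have -> : X *m B^t* = L by rewrite -[RHS](mulmxtVK L Bu) -XE.
exact: XE.
Qed.

Lemma mulmx_adj_eq0 m n (M : 'M[C]_(m, n)) : M *m M^t* = 0 -> M = 0.
Proof.
move=> M0; apply/row_matrixP => i; rewrite row0; apply/eqP.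
rewrite -(dnorm_eq0 (@dotmx C n)) /= dotmxE; apply/eqP.
have := congr1 (fun N : 'M_m => N i i) M0; rewrite !mxE => Mi0.
rewrite -[RHS]Mi0.
by apply: eq_bigr => k _; rewrite !mxE.
Qed.

(** Every relation between the rows, and every orthonormality relation between
    combinations of them, can be read off the Gram matrix [X X^*]. *)
Lemma unitary_of_gram m n (X Y : 'M[C]_(m, n)) : X *m X^t* = Y *m Y^t* ->
  exists2 U : 'M[C]_n, U \is unitarymx & Y = X *m U.
Proof.
move=> XY; have [r [K [Bu XE]]] := orthonormalizing_rows _ _ X.
have gramM p p' (P : 'M[C]_(p, m)) (Q : 'M_(p', m)) :
    P *m Y *m (Q *m Y)^t* = P *m X *m (Q *m X)^t*.
  by rewrite !mxadjM !mulmxA -!(mulmxA P) XY.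
have B'u : K *m Y \is unitarymx.
  by apply/unitarymxP; rewrite gramM; apply/unitarymxP.
set L := X *m (K *m X)^t* in XE.
(* The relation X = L (K X) is inherited by Y, because the defect of Y has the
   same Gram matrix as the defect of X. *)
have YE : Y = L *m (K *m Y).
  apply/eqP; rewrite -subr_eq0; apply/eqP/mulmx_adj_eq0.
  rewrite mulmxA -[X in X - _]mul1mx -mulmxBl gramM mulmxBl mul1mx -mulmxA -XE.
  by rewrite subrr mul0mx.
have [U Uu KU] := unitarymx_transitive _ _ _ _ Bu B'u; exists U => //.
by rewrite YE KU mulmxA -XE.
Qed.

Lemma dotcv_mx n (x y : 'cV[C]_n) : x^T *m (y^T)^t* = (dotcv x y)%:M.
Proof. by rewrite dotcvE dotmxE -mx11_scalar. Qed.

Lemma dotcv_trace n (x y : 'cV[C]_n) : dotcv x y = \tr (x *m y^t*).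
Proof.
rewrite mxtrace_mulC trace_mx11 mxE; apply: eq_bigr => i _.
by rewrite !mxE mulrC.
Qed.

Lemma dotcv_unitary n (U : 'M[C]_n) (x y : 'cV[C]_n) : U \is unitarymx ->
  dotcv (U *m x) (U *m y) = dotcv x y.
Proof.
move=> Uu; rewrite !dotcv_trace mxadjM mulmxA mxtrace_mulC !mulmxA.
by rewrite -[U^t*]mul1mx mulmxKtV // mul1mx.
Qed.

Lemma unitary_of_gram2 n (a b x y : 'cV[C]_n) :
  dotcv a a = dotcv x x -> dotcv a b = dotcv x y -> dotcv b b = dotcv y y ->
  exists U : 'M[C]_n, [/\ U \is unitarymx, x = U *m a & y = U *m b].
Proof.
move=> aa ab bb.
have ba : dotcv b a = dotcv y x.
  by rewrite dotcv_hermitian ab -dotcv_hermitian.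
have [|U Uu] := unitary_of_gram _ _ (col_mx a^T b^T) (col_mx x^T y^T).
  by rewrite !tr_col_mx !map_row_mx !mul_col_row !dotcv_mx aa ab ba bb.
rewrite mul_col_mx => /eq_col_mx[xE yE].
exists U^T; rewrite trmx_unitary; split=> //; apply: trmx_inj.
  by rewrite trmx_mul trmxK.
by rewrite trmx_mul trmxK.
Qed.

(** * Joint numerical ranges of rank one matrices *)

Variable d : nat.

Lemma SqP (H : lmodType C) (dot : {dot H for conjC}) (q : C) (x y : H) :
  Sq dot q (x, y) <-> [/\ dot x x = 1, dot y y = 1 & dot x y = q].
Proof.
have hnorm1 z : hnorm dot z = 1 <-> dot z z = 1.
  rewrite /hnorm; split=> [z1|->]; last exact: sqrtC1.
  by rewrite -[dot z z]sqrtCK z1 expr1n.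
by split=> -[/hnorm1 ? /hnorm1 ? ?].
Qed.

(** The unitary group acts transitively on the pairs of unit vectors with a given
    inner product, and the trace turns the orbit of [(a, b)] into the values
    [<T_k x, y>]. *)
Lemma JtWC_rank1 n (a b : 'cV[C]_n) (T : 'I_d -> 'M[C]_n) :
  dotcv a a = 1 -> dotcv b b = 1 ->
  JtWC (a *m b^t*) T = JtWqmx (dotcv a b) T.
Proof.
move=> a1 b1.
have trE U : \row_k \tr (a *m b^t* *m U^t* *m T k *m U) =
             \row_k dotcv (T k *m (U *m a)) (U *m b) :> 'rV[C]_d.
  apply/rowP => k; rewrite !mxE dotcv_trace mxadjM.
  by rewrite [LHS]mxtrace_mulC [in LHS]mulmxA [LHS]mxtrace_mulC !mulmxA.
apply/seteqP; split=> xi /= [].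
  move=> U Uu <-; rewrite trE; exists (U *m a, U *m b) => //.
  by apply/SqP; rewrite /= !dotcv_unitary.
move=> [x y] /SqP[x1 y1 xy] <-.
have [|||U [Uu -> ->]] := unitary_of_gram2 _ a b x y; rewrite ?a1 ?b1 //.
by exists U => //; rewrite trE.
Qed.

Lemma JtWCZ n (mu : C) (A : 'M[C]_n) (T : 'I_d -> 'M[C]_n) :
  JtWC (mu *: A) T = [set mu *: xi | xi in JtWC A T].
Proof.
have trE U : \row_k \tr (mu *: A *m U^t* *m T k *m U) =
    mu *: \row_k \tr (A *m U^t* *m T k *m U) :> 'rV[C]_d.
  by apply/rowP => k; rewrite !mxE -!scalemxAl mxtraceZ.
apply/seteqP; split=> xi /=.
  by move=> [U Uu <-]; rewrite trE; eexists=> //; exists U.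
by move=> [_ [U Uu <-] <-]; exists U; rewrite // trE.
Qed.

Lemma unit_vector_scaling n (u : 'cV[C]_n) : u != 0 ->
  exists (c : C) (a : 'cV[C]_n), [/\ c != 0, dotcv a a = 1 & u = c *: a].
Proof.
move=> u0; pose c := sqrtC (dotcv u u).
have c0 : c != 0 by rewrite sqrt_dnorm_eq0.
have cc : `|c| ^+ 2 = dotcv u u.
  by rewrite ger0_norm ?sqrtCK // sqrt_dnorm_ge0.
exists c, (c^-1 *: u); split=> //; last by rewrite scalerA divff // scale1r.
rewrite dnormZ /= -cc normfV exprVn mulVf //.
by rewrite expf_neq0 // normr_eq0.
Qed.

(** A factorization through rank one gives unit vectors [a] and [b] up to scalars;
    the phase of [<a, b>] is then moved from [a] to [mu]. *)
Lemma rank1_normal_form n (A : 'M[C]_n) : \rank A = 1%N ->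
  exists (mu : C) (a b : 'cV[C]_n),
    [/\ mu != 0, dotcv a a = 1, dotcv b b = 1, 0 <= dotcv a b <= 1
      & A = mu *: (a *m b^t*)].
Proof.
move=> rA.
have [u [w AE]] : exists (u : 'cV[C]_n) (w : 'cV[C]_n), A = u *m w^t*.
  have := mulmx_base A; move: (col_base A) (row_base A); rewrite rA => u v <-.
  by exists u, (v^t*); rewrite trmxCK.
have A0 : A != 0 by rewrite -mxrank_eq0 rA.
have u0 : u != 0 by apply: contraNneq A0 => u0; rewrite AE u0 mul0mx.
have w0 : w != 0.
  by apply: contraNneq A0 => w0; rewrite AE w0 trmx0 map_mx0 mulmx0.
have [c [a [c0 a1 uE]]] := unit_vector_scaling _ _ u0.
have [e [b [e0 b1 wE]]] := unit_vector_scaling _ _ w0.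
pose p := dotcv a b.
have [om om1 pE] : exists2 om : C, `|om| = 1 & p = om * `|p|.
  have [p0|p0] := eqVneq p 0.
    by exists 1; rewrite ?normr1 // p0 normr0 mulr0.
  exists (p / `|p|); last by rewrite divfK // normr_eq0.
  by rewrite normrM normfV normr_id divff // normr_eq0.
have om0 : om != 0 by rewrite -normr_eq0 om1 oner_eq0.
have q1 : `|p| <= 1.
  by have [] := CauchySchwarz_sqrt (@dotcv C n) a b; rewrite /= a1 b1 sqrtC1 mulr1.
exists (c * e^* * om), (om^-1 *: a), b; split=> //.
- by rewrite !mulf_neq0 // conjC_eq0.
- by rewrite dnormZ /= a1 normfV om1 invr1 expr1n mulr1.
- by rewrite linearZl_LR /= -/p pE mulKf // normr_ge0.
rewrite AE uE wE linearZ /= map_mxZ -!scalemxAl -scalemxAr !scalerA.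
by congr (_ *: _); rewrite mulfK.
Qed.

(** * The matrix C of parts (i) and (ii) *)

Definition Cq_left : 'cV[C]_2 := \col_i (i == 0)%:R.
Definition Cq_right (q : C) : 'cV[C]_2 :=
  \col_i if i == 0 then q^* else sqrtC (1 - `|q| ^+ 2).

Lemma conjC_sqrt1B (q : C) : `|q| <= 1 ->
  (sqrtC (1 - `|q| ^+ 2))^* = sqrtC (1 - `|q| ^+ 2).
Proof.
move=> q1; apply/CrealP/ger0_real.
by rewrite sqrtC_ge0 subr_ge0 expr_le1.
Qed.

Lemma CqE (q : C) : `|q| <= 1 -> Cq q = Cq_left *m (Cq_right q)^t*.
Proof.
move=> q1; apply/matrixP => i j; rewrite !mxE big_ord1 !mxE.
case: eqP => _; rewrite ?mul0r // mul1r.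
by case: eqP; rewrite ?conjCK ?conjC_sqrt1B.
Qed.

Lemma dotcv_Cq_left : dotcv Cq_left Cq_left = 1.
Proof.
by rewrite /dotcv big_ord_recl big_ord1 !mxE /= mul0r addr0 mul1r conjC1.
Qed.

Lemma dotcv_Cq_right (q : C) : `|q| <= 1 -> dotcv (Cq_right q) (Cq_right q) = 1.
Proof.
move=> q1; rewrite /dotcv big_ord_recl big_ord1 !mxE /= conjC_sqrt1B // -expr2.
by rewrite sqrtCK conjCK mulrC -normCK addrC subrK.
Qed.

Lemma dotcv_Cq (q : C) : dotcv Cq_left (Cq_right q) = q.
Proof.
by rewrite /dotcv big_ord_recl big_ord1 !mxE /= mul0r addr0 mul1r conjCK.
Qed.

Lemma dotcv_col_mx0 m n (x y : 'cV[C]_m) :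
  dotcv (col_mx x (0 : 'cV_n)) (col_mx y 0) = dotcv x y.
Proof.
rewrite /dotcv big_split_ord /= [X in _ + X]big1 ?addr0 => [|i _].
  by apply: eq_bigr => i _; rewrite !col_mxEu.
by rewrite !col_mxEd mxE mul0r.
Qed.

Lemma JtWC_Cq (q : C) (T : 'I_d -> 'M[C]_2) : `|q| <= 1 ->
  JtWC (Cq q) T = JtWqmx q T.
Proof.
move=> q1; rewrite CqE // JtWC_rank1 ?dotcv_Cq //.
  exact: dotcv_Cq_left.
exact: dotcv_Cq_right.
Qed.

Lemma JtWC_Cq_block m (q : C) (T : 'I_d -> 'M[C]_(2 + m)) : `|q| <= 1 ->
  JtWC (block_mx (Cq q) 0 0 (0 : 'M_m)) T = JtWqmx q T.
Proof.
move=> q1.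
have -> : block_mx (Cq q) 0 0 (0 : 'M_m) =
    col_mx Cq_left 0 *m (col_mx (Cq_right q) 0)^t*.
  rewrite tr_col_mx map_row_mx mul_col_row -CqE // !mul0mx.
  by rewrite trmx0 map_mx0 mulmx0.
rewrite JtWC_rank1 ?dotcv_col_mx0 ?dotcv_Cq //.
  exact: dotcv_Cq_left.
exact: dotcv_Cq_right.
Qed.

(** * Coordinates in an orthonormal basis *)

Section Coordinates.
Variables (H : vectType C) (dot : {dot H for conjC}) (n : nat) (e : n.-tuple H).
Hypotheses (e_basis : basis_of fullv e) (e_on : orthonormal dot e).

Definition of_coords (v : 'cV[C]_n) : H := \sum_i v i 0 *: tnth e i.

Lemma of_coords_surj x : exists v, x = of_coords v.
Proof.
exists (\col_i coord e i x); rewrite {1}(coord_basis e_basis (memvf x)).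
by apply: eq_bigr => i _; rewrite mxE (tnth_nth 0).
Qed.

Lemma dot_tnth i j : dot (tnth e i) (tnth e j) = (i == j)%:R.
Proof.
have /orthonormalP[Ue ->] := e_on; rewrite ?mem_tnth //.
by rewrite (inj_eq (tuple_uniqP e Ue)).
Qed.

Lemma dot_of_coordsr (x : H) w :
  dot x (of_coords w) = \sum_i dot x (tnth e i) * (w i 0)^*.
Proof.
rewrite linear_sumr; apply: eq_bigr => i _.
by rewrite linearZr_LR /= mulrC.
Qed.

Lemma dot_of_coords v w : dot (of_coords v) (of_coords w) = dotcv v w.
Proof.
rewrite dot_of_coordsr; apply: eq_bigr => i _; congr (_ * _).
rewrite linear_sumlz (bigD1 i) //= big1 => [|j ji].
  by rewrite addr0 linearZl_LR /= dot_tnth eqxx mulr1.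
by rewrite linearZl_LR /= dot_tnth (negPf ji) mulr0.
Qed.

Lemma dot_opmx (f : 'End(H)) v w :
  dot (f (of_coords v)) (of_coords w) = dotcv (opmx dot e f *m v) w.
Proof.
rewrite dot_of_coordsr; apply: eq_bigr => i _; congr (_ * _).
rewrite linear_sum linear_sumlz mxE; apply: eq_bigr => j _.
by rewrite linearZ linearZl_LR /= mxE mulrC.
Qed.

Lemma JtWq_opmx (q : C) (T : 'I_d -> 'End(H)) :
  JtWq dot q (fun k => T k) = JtWqmx q (fun k => opmx dot e (T k)).
Proof.
have SqE v w : Sq dot q (of_coords v, of_coords w) <-> Sq (@dotcv C n) q (v, w).
  by rewrite !SqP !dot_of_coords.
have rowE v w : \row_k dot (T k (of_coords v)) (of_coords w) =
    \row_k dotcv (opmx dot e (T k) *m v) w :> 'rV[C]_d.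
  by apply/rowP => k; rewrite !mxE dot_opmx.
apply/seteqP; split=> xi [[x y]].
  have [v ->] := of_coords_surj x; have [w ->] := of_coords_surj y.
  by move=> /SqE S <- /=; exists (v, w); rewrite // rowE.
by move=> /SqE S <- /=; exists (of_coords x, of_coords y); rewrite // rowE.
Qed.

End Coordinates.

End JointRanges.

Theorem theorem11 (R : realType) (d : nat) (hd : (0 < d)%N) :
  [/\ (* (i) *)
      forall (H : vectType R[i]) (dot : {dot H for conjC}) (q : R[i])
        (T : 'I_d -> 'End(H)) (e : 2.-tuple H),
        \dim {:H} = 2%N -> `|q| <= 1 -> basis_of fullv e -> orthonormal dot e ->
        JtWq dot q (fun k => T k) = JtWC (Cq q) (fun k => opmx dot e (T k)),
      (* (ii), with n = 2 + m *)
      forall (m : nat) (q : R[i]) (T : 'I_d -> 'M[R[i]]_(2 + m)),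
        `|q| <= 1 ->
        JtWqmx q T = JtWC (block_mx (Cq q) 0 0 (0 : 'M_m)) T
    & (* (iii) *)
      forall (n : nat) (A : 'M[R[i]]_n),
        (2 <= n)%N -> \rank A = 1%N ->
        exists q mu : R[i],
          [/\ 0 <= q <= 1, mu != 0
            & forall T : 'I_d -> 'M[R[i]]_n,
                JtWC A T = [set mu *: xi | xi in JtWqmx q T]]].
Proof.
split.
- move=> H dot q T e _ q1 e_basis e_on.
  by rewrite JtWC_Cq // (JtWq_opmx _ _ _ _ _ e_basis).
- by move=> m q T q1; rewrite JtWC_Cq_block.
move=> n A _ /rank1_normal_form[mu [a [b [mu0 a1 b1 q1 ->]]]].
exists (dotcv a b), mu; split=> // T.
by rewrite JtWCZ JtWC_rank1.
Qed.
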